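(* Let $\mathbb{C}$ be a category with weak finite limits, and suppose that $\mathbb{C}$ has right adjoints to weak pullback functors. If $\mathbb{C}$ has full diagrams, then the exact completion $\mathbb{C}_{\mathrm{ex}}$ is cartesian closed.
   Context: Weak limits are defined as limits but without requiring uniqueness of the universal arrow. Weak pullback functors. For a category $\mathbb{X}$ let $\mathbb{X}_{\mathrm{po}}$ be its poset reflection (objects preordered by existence of an arrow, modulo equivalence). For an arrow $f\colon Y\to X$ of $\mathbb{C}$, weak pullback along $f$ induces a well-defined monotone map $(\mathbb{C}/X)_{\mathrm{po}}\to(\mathbb{C}/Y)_{\mathrm{po}}$. ''$\mathbb{C}$ has right adjoints to weak pullback functors'' means that this map has a right adjoint for every arrow $f$ of $\mathbb{C}$. Full diagram. Let $X,Y$ be objects of $\mathbb{C}$. A full diagram from $X$ to $Y$ consists of a weak product $U\xleftarrow{p_1}V\xrightarrow{p_2}X$ and an arrow $f\colon V\to Y$ such that for every object $U'$, weak product $U'\xleftarrow{p_1'}V'\xrightarrow{p_2'}X$ and arrow $f'\colon V'\to Y$, there are an arrow $h\colon U'\to U$, a weak pullback $U'\xleftarrow{r}P\xrightarrow{q}V$ of $U'\xrightarrow{h}U\xleftarrow{p_1}V$ and an arrow $k\colon P\to V'$ such that $p_1'k=r$, $p_2'k=p_2q$ and $f'k=fq$. $\mathbb{C}$ has full diagrams if there is one from $X$ to $Y$ for all objects $X,Y$. Exact completion (ex/wlex completion). A pseudo equivalence relation in $\mathbb{C}$ is a parallel pair $r_1,r_2\colon R\rightrightarrows X$ (not necessarily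 jointly monic) that is reflexive (there is $\rho\colon X\to R$ with $r_1\rho=r_2\rho=\mathrm{id}_X$), symmetric (there is $\sigma\colon R\to R$ with $r_1\sigma=r_2$, $r_2\sigma=r_1$) and transitive (for a weak pullback $R\xleftarrow{a}T\xrightarrow{b}R$ of $r_2,r_1$ there is $\tau\colon T\to R$ with $r_1\tau=r_1a$, $r_2\tau=r_2b$). Objects of $\mathbb{C}_{\mathrm{ex}}$ are pseudo equivalence relations in $\mathbb{C}$; an arrow from $R\rightrightarrows X$ to $(s_1,s_2)\colon S\rightrightarrows Y$ is an equivalence class of arrows $f\colon X\to Y$ for which there is $\hat f\colon R\to S$ with $s_i\hat f=fr_i$, where $f\sim f'$ if there is $t\colon X\to S$ with $s_1t=f$, $s_2t=f'$. $\mathbb{C}_{\mathrm{ex}}$ is a (Barr-)exact category with finite limits. *)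

(* Defs.v *)
From Stdlib Require Import List Relations ClassicalEpsilon ProofIrrelevance.
From Stdlib Require Import FunctionalExtensionality PropExtensionality.
From Stdlib Require Import ssreflect.

Set Implicit Arguments.
Unset Strict Implicit.
Unset Printing Implicit Defensive.

Definition quotient (T : Type) (E : relation T) : Type :=
  {P : T -> Prop | exists x, P = E x}.

Definition class (T : Type) (E : relation T) (x : T) : quotient E :=
  exist _ (E x) (ex_intro _ x eq_refl).

Lemma class_surj (T : Type) (E : relation T) (q : quotient E) :
  exists x, class E x = q.
Proof. by case: q => P [x e]; exists x; subst P. Qed.

Definition repr (T : Type) (E : relation T) (q : quotient E) : T :=
  proj1_sig (constructive_indefinite_description _ (class_surj q)).

Lemma reprK (T : Type) (E : relation T) (q : quotient E) : class E (repr q) = q.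
Proof. exact: proj2_sig (constructive_indefinite_description _ (class_surj q)). Qed.

Lemma class_eq (T : Type) (E : relation T) (HE : equivalence T E) (x y : T) :
  class E x = class E y <-> E x y.
Proof.
case: HE => Er Et Es; split=> [e|exy].
  have e' : E x = E y := f_equal (@proj1_sig _ _) e.
  by rewrite e'; apply: Er.
have e : E x = E y.
  apply: functional_extensionality => z; apply: propositional_extensionality.
  split=> h; first by apply: (Et y x z) => //; apply: Es.
  by apply: (Et x y z).
apply: eq_sig_hprop => [P p q|]; [exact: proof_irrelevance | exact: e].
Qed.

Lemma repr_class (T : Type) (E : relation T) (HE : equivalence T E) (x : T) :
  E (repr (class E x)) x.
Proof. by apply/(class_eq HE); rewrite reprK. Qed.

Record category : Type := Category {
  ob :> Type;
  hom : ob -> ob -> Type;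
  idm : forall a : ob, hom a a;
  comp : forall a b c : ob, hom b c -> hom a b -> hom a c;
  comp_idl : forall (a b : ob) (f : hom a b), comp (idm b) f = f;
  comp_idr : forall (a b : ob) (f : hom a b), comp f (idm a) = f;
  comp_assoc : forall (a b c d : ob) (f : hom a b) (g : hom b c) (h : hom c d),
    comp h (comp g f) = comp (comp h g) f
}.

Arguments hom {_} _ _.
Arguments idm {_} _.
Arguments comp {_} [_ _ _] _ _.

Declare Scope cat_scope.
Delimit Scope cat_scope with cat.
Local Open Scope cat_scope.
Notation "g ∘ f" := (comp g f) (at level 40, left associativity) : cat_scope.

Record functor (J C : category) : Type := Functor {
  fobj :> J -> C;
  fmap : forall i j : J, hom i j -> hom (fobj i) (fobj j);
  fmap_id : forall i : J, fmap (idm i) = idm (fobj i);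
  fmap_comp : forall (i j k : J) (u : hom i j) (v : hom j k),
    fmap (v ∘ u) = fmap v ∘ fmap u
}.

Definition is_cone (J C : category) (D : functor J C) (L : C)
    (p : forall i : J, hom L (D i)) : Prop :=
  forall (i j : J) (u : hom i j), fmap D u ∘ p i = p j.

Definition is_weak_limit (J C : category) (D : functor J C) (L : C)
    (p : forall i : J, hom L (D i)) : Prop :=
  is_cone p /\
  forall (T : C) (t : forall i : J, hom T (D i)), is_cone t ->
    exists m : hom T L, forall i : J, p i ∘ m = t i.

Definition finite_type (T : Type) : Prop := exists l : list T, forall x, In x l.

Definition finite_category (J : category) : Prop :=
  finite_type J /\ forall i j : J, finite_type (hom i j).

Definition has_weak_finite_limits (C : category) : Prop :=
  forall (J : category) (D : functor J C), finite_category J ->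
    exists (L : C) (p : forall i : J, hom L (D i)), is_weak_limit p.

Definition is_weak_product (C : category) (A B P : C)
    (p1 : hom P A) (p2 : hom P B) : Prop :=
  forall (T : C) (t1 : hom T A) (t2 : hom T B),
    exists m : hom T P, p1 ∘ m = t1 /\ p2 ∘ m = t2.

Definition is_weak_pullback (C : category) (A B D : C)
    (f : hom A D) (g : hom B D) (P : C) (p : hom P A) (q : hom P B) : Prop :=
  f ∘ p = g ∘ q /\
  forall (T : C) (s : hom T A) (t : hom T B), f ∘ s = g ∘ t ->
    exists m : hom T P, p ∘ m = s /\ q ∘ m = t.

Inductive cospan_ob : Set := cospan_l | cospan_r | cospan_c.

Definition cospan_hom (i j : cospan_ob) : Set :=
  match i, j with
  | cospan_l, cospan_l | cospan_r, cospan_r => unit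
  | _, cospan_c => unit
  | _, _ => Empty_set
  end.

Definition cospan_id (i : cospan_ob) : cospan_hom i i :=
  match i with cospan_l | cospan_r | cospan_c => tt end.

Definition cospan_comp (i j k : cospan_ob) :
  cospan_hom j k -> cospan_hom i j -> cospan_hom i k.
Proof. by case: i; case: j; case: k => //= [] []. Defined.

Lemma cospan_hom_unique (i j : cospan_ob) (u v : cospan_hom i j) : u = v.
Proof. by case: i u v; case: j => /= [] [] []. Qed.

Definition cospan : category :=
  @Category cospan_ob cospan_hom cospan_id cospan_comp
    (fun _ _ _ => cospan_hom_unique _ _) (fun _ _ _ => cospan_hom_unique _ _)
    (fun _ _ _ _ _ _ _ => cospan_hom_unique _ _).

Lemma cospan_finite : finite_category cospan.
Proof.
split; first by exists (cospan_l :: cospan_r :: cospan_c :: nil); case=> /=; tauto.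
by do 2!case; (exists nil; by case) || (exists (tt :: nil); by case; left).
Qed.

Definition cospan_diagram (C : category) (A B D : C)
    (f : hom A D) (g : hom B D) : functor cospan C.
Proof.
pose o (i : cospan) : C :=
  match i with cospan_l => A | cospan_r => B | cospan_c => D end.
pose m (i j : cospan) : hom i j -> hom (o i) (o j) :=
  match i, j return cospan_hom i j -> hom (o i) (o j) with
  | cospan_l, cospan_l => fun _ => idm A
  | cospan_r, cospan_r => fun _ => idm B
  | cospan_c, cospan_c => fun _ => idm D
  | cospan_l, cospan_c => fun _ => f
  | cospan_r, cospan_c => fun _ => g
  | _, _ => fun u => match u with end
  end.
apply: (@Functor cospan C o m) => [[]//|].
by case; case; case => //= [] [] [] /=; rewrite ?comp_idl ?comp_idr.
Defined.

Lemma weak_pullback_exists (C : category) (HC : has_weak_finite_limits C)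
    (A B D : C) (f : hom A D) (g : hom B D) :
  exists (P : C) (p : hom P A) (q : hom P B), is_weak_pullback f g p q.
Proof.
have [L [p [pc pw]]] := HC _ (cospan_diagram f g) cospan_finite.
exists L, (p cospan_l), (p cospan_r); split.
  have e1 := pc cospan_l cospan_c tt; have e2 := pc cospan_r cospan_c tt.
  by rewrite /= in e1 e2; rewrite e1 e2.
move=> T s t e.
pose c (i : cospan) : hom T (cospan_diagram f g i) :=
  match i with cospan_l => s | cospan_r => t | cospan_c => f ∘ s end.
have [|m Hm] := pw T c; last by exists m; split; [exact: Hm cospan_l | exact: Hm cospan_r].
by do 2!case=> //=; move=> _; rewrite ?comp_idl.
Qed.

Record slice_ob (C : category) (X : C) : Type := SliceOb {
  sdom : C;
  sarr : hom sdom X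
}.

Definition slice (C : category) (X : C) : category.
Proof.
refine (@Category (slice_ob X)
  (fun a b => {h : hom (sdom a) (sdom b) | sarr b ∘ h = sarr a})
  (fun a => exist _ (idm (sdom a)) (comp_idr (sarr a)))
  (fun a b c g f => exist _ (proj1_sig g ∘ proj1_sig f) _) _ _ _).
- by move=> a b f; apply: eq_sig_hprop => [h p q|/=];
    [exact: proof_irrelevance | exact: comp_idl].
- by move=> a b f; apply: eq_sig_hprop => [h p q|/=];
    [exact: proof_irrelevance | exact: comp_idr].
- by move=> a b c d f g h; apply: eq_sig_hprop => [k p q|/=];
    [exact: proof_irrelevance | exact: comp_assoc].
Unshelve.
by rewrite comp_assoc (proj2_sig g) (proj2_sig f).
Defined.

Definition equi (X : category) : relation X :=
  fun a b => inhabited (hom a b) /\ inhabited (hom b a).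

Definition po (X : category) : Type := quotient (@equi X).

Definition po_class (X : category) (a : X) : po X := class (@equi X) a.

Definition po_le (X : category) (A B : po X) : Prop :=
  exists a b : X, po_class a = A /\ po_class b = B /\ inhabited (hom a b).

Definition monotone (X Y : category) (L : po X -> po Y) : Prop :=
  forall A B : po X, po_le A B -> po_le (L A) (L B).

Definition po_adjoint (X Y : category) (L : po X -> po Y) (R : po Y -> po X) : Prop :=
  forall (A : po X) (B : po Y), po_le (L A) B <-> po_le A (R B).

Definition is_weak_pullback_map (C : category) (X Y : C) (f : hom Y X)
    (L : po (slice X) -> po (slice Y)) : Prop :=
  forall (a : slice X) (b : slice Y) (q : hom (sdom b) (sdom a)),
    is_weak_pullback f (sarr a) (sarr b) q -> L (po_class a) = po_class b.

(* With weak pullbacks, [L] exists, is monotone and is unique: see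
   [weak_pullback_map_exists]. *)
Definition has_right_adjoints_to_weak_pullback (C : category) : Prop :=
  forall (X Y : C) (f : hom Y X),
    exists L : po (slice X) -> po (slice Y),
      is_weak_pullback_map f L /\
      exists R : po (slice Y) -> po (slice X), po_adjoint L R.

Lemma equi_equivalence (X : category) : equivalence X (@equi X).
Proof.
split=> [a|a b c [[f] [f']] [[g] [g']]|a b [f g]].
- by split; exists; exact: idm.
- by split; exists; [exact: (g ∘ f) | exact: (f' ∘ g')].
- by split.
Qed.

Lemma po_classP (X : category) (a b : X) : po_class a = po_class b <-> equi a b.
Proof. exact: class_eq (@equi_equivalence X) a b. Qed.

Lemma po_leE (X : category) (a b : X) :
  po_le (po_class a) (po_class b) <-> inhabited (hom a b).
Proof.
split=> [[a' [b' [/po_classP [[f] [f']] [/po_classP [[g] [g']] [h]]]]]|h].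
  by exists; exact: (g ∘ (h ∘ f')).
by exists a, b.
Qed.

(* Weak pullback along [f] sends arrows of the slice to arrows of the slice. *)
Lemma weak_pullback_hom (C : category) (X Y : C) (f : hom Y X)
    (a a' : slice X) (b b' : slice Y)
    (q : hom (sdom b) (sdom a)) (q' : hom (sdom b') (sdom a')) :
  is_weak_pullback f (sarr a) (sarr b) q ->
  is_weak_pullback f (sarr a') (sarr b') q' ->
  inhabited (hom a a') -> inhabited (hom b b').
Proof.
move=> [e _] [_ u] [[h eh]].
have [|m [e1 _]] := u _ (sarr b) (h ∘ q); first by rewrite comp_assoc eh.
by exists; exists m.
Qed.

Lemma weak_pullback_map_exists (C : category) (HC : has_weak_finite_limits C)
    (X Y : C) (f : hom Y X) :
  exists L, is_weak_pullback_map f L /\ monotone L /\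
    forall L', is_weak_pullback_map f L' -> L' = L.
Proof.
have wp (a : slice X) : exists (b : slice Y),
    exists q : hom (sdom b) (sdom a), is_weak_pullback f (sarr a) (sarr b) q.
  have [P [p [q H]]] := weak_pullback_exists HC f (sarr a).
  by exists (SliceOb p), q.
pose F a := proj1_sig (constructive_indefinite_description _ (wp a)).
have FP a := proj2_sig (constructive_indefinite_description _ (wp a)).
have Fh a a' : inhabited (hom a a') -> inhabited (hom (F a) (F a')).
  by have [q H] := FP a; have [q' H'] := FP a'; exact: weak_pullback_hom H H'.
pose L (A : po (slice X)) := po_class (F (repr A)).
have HL : is_weak_pullback_map f L.
  move=> a b q H; apply/po_classP.
  have [q' H'] := FP (repr (po_class a)).
  have [h1 h2] := repr_class (@equi_equivalence (slice X)) a.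
  by split; [exact: weak_pullback_hom H' H h1 | exact: weak_pullback_hom H H' h2].
have LE a : L (po_class a) = po_class (F a) by have [q H] := FP a; exact: HL H.
exists L; split=> //; split=> [A B|L' HL'].
  by move=> [a [b [<- [<- h]]]]; rewrite !LE; apply/po_leE/Fh.
apply: functional_extensionality => A; rewrite -(reprK A).
by have [q H] := FP (repr A); rewrite (HL' _ _ _ H) (HL _ _ _ H).
Qed.

Definition is_full_diagram (C : category) (X Y U V : C)
    (p1 : hom V U) (p2 : hom V X) (f : hom V Y) : Prop :=
  is_weak_product p1 p2 /\
  forall (U' V' : C) (p1' : hom V' U') (p2' : hom V' X) (f' : hom V' Y),
    is_weak_product p1' p2' ->
    exists (h : hom U' U) (P : C) (r : hom P U') (q : hom P V) (k : hom P V'),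
      is_weak_pullback h p1 r q /\
      p1' ∘ k = r /\ p2' ∘ k = p2 ∘ q /\ f' ∘ k = f ∘ q.

Definition has_full_diagrams (C : category) : Prop :=
  forall X Y : C, exists (U V : C) (p1 : hom V U) (p2 : hom V X) (f : hom V Y),
    is_full_diagram p1 p2 f.

Definition pseudo_reflexive (C : category) (R X : C) (r1 r2 : hom R X) : Prop :=
  exists rho : hom X R, r1 ∘ rho = idm X /\ r2 ∘ rho = idm X.

Definition pseudo_symmetric (C : category) (R X : C) (r1 r2 : hom R X) : Prop :=
  exists sigma : hom R R, r1 ∘ sigma = r2 /\ r2 ∘ sigma = r1.

(* Whether [tau] exists does not depend on the chosen weak pullback. *)
Definition pseudo_transitive (C : category) (R X : C) (r1 r2 : hom R X) : Prop :=
  exists (T : C) (a b : hom T R), is_weak_pullback r2 r1 a b /\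
    exists tau : hom T R, r1 ∘ tau = r1 ∘ a /\ r2 ∘ tau = r2 ∘ b.

Record pseudo_eqrel (C : category) : Type := PseudoEqrel {
  carrier : C;
  rel : C;
  src : hom rel carrier;
  tgt : hom rel carrier;
  per_refl : pseudo_reflexive src tgt;
  per_sym : pseudo_symmetric src tgt;
  per_trans : pseudo_transitive src tgt
}.

Definition ex_premor (C : category) (R S : pseudo_eqrel C) : Type :=
  {f : hom (carrier R) (carrier S) |
    exists fh : hom (rel R) (rel S),
      src S ∘ fh = f ∘ src R /\ tgt S ∘ fh = f ∘ tgt R}.

Definition ex_eqv (C : category) (R S : pseudo_eqrel C) : relation (ex_premor R S) :=
  fun f f' => exists t : hom (carrier R) (rel S),
    src S ∘ t = proj1_sig f /\ tgt S ∘ t = proj1_sig f'.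

Definition ex_hom (C : category) (R S : pseudo_eqrel C) : Type := quotient (@ex_eqv C R S).

Lemma ex_eqv_equivalence (C : category) (R S : pseudo_eqrel C) :
  equivalence (ex_premor R S) (@ex_eqv C R S).
Proof.
split=> [f|f g h [t [t1 t2]] [u [u1 u2]]|f g [t [t1 t2]]].
- have [rho [e1 e2]] := per_refl S; exists (rho ∘ proj1_sig f).
  by rewrite !comp_assoc e1 e2 !comp_idl.
- have [T [a [b [[_ w] [tau [e1 e2]]]]]] := per_trans S.
  have [|m [m1 m2]] := w _ t u; first by rewrite t2 u1.
  by exists (tau ∘ m); rewrite !comp_assoc e1 e2 -!comp_assoc m1 m2.
- have [sigma [e1 e2]] := per_sym S; exists (sigma ∘ t).
  by rewrite !comp_assoc e1 e2.
Qed.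

Definition ex_preid (C : category) (R : pseudo_eqrel C) : ex_premor R R.
Proof.
exists (idm (carrier R)); exists (idm (rel R)).
by rewrite !comp_idl !comp_idr.
Defined.

Definition ex_precomp (C : category) (R S T : pseudo_eqrel C)
  (g : ex_premor S T) (f : ex_premor R S) : ex_premor R T.
Proof.
exists (proj1_sig g ∘ proj1_sig f).
case: f g => [f [fh [f1 f2]]] [g [gh [g1 g2]]] /=; exists (gh ∘ fh).
by rewrite !comp_assoc g1 g2 -!comp_assoc f1 f2.
Defined.

Definition ex_id (C : category) (R : pseudo_eqrel C) : ex_hom R R :=
  class (@ex_eqv C R R) (ex_preid R).

(* Composing representatives; [ex_comp_class] shows the choice is irrelevant. *)
Definition ex_comp (C : category) (R S T : pseudo_eqrel C)
    (G : ex_hom S T) (F : ex_hom R S) : ex_hom R T :=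
  class (@ex_eqv C R T) (ex_precomp (repr G) (repr F)).

Lemma ex_comp_class (C : category) (R S T : pseudo_eqrel C)
    (g : ex_premor S T) (f : ex_premor R S) :
  ex_comp (class (@ex_eqv C S T) g) (class (@ex_eqv C R S) f) =
  class (@ex_eqv C R T) (ex_precomp g f).
Proof.
apply/(class_eq (@ex_eqv_equivalence C R T)).
have [t [t1 t2]] := repr_class (@ex_eqv_equivalence C S T) g.
have [u [u1 u2]] := repr_class (@ex_eqv_equivalence C R S) f.
set g' := repr _ in t1 t2 *; set f' := repr _ in u1 u2 *.
have [_ trans _] := @ex_eqv_equivalence C R T.
apply: (trans _ (ex_precomp g' f)); last first.
  by exists (t ∘ proj1_sig f); rewrite /= !comp_assoc t1 t2.
case: g' {t1 t2} => k [kh [k1 k2]]; exists (kh ∘ u) => /=.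
by rewrite !comp_assoc k1 k2 -!comp_assoc u1 u2.
Qed.

Lemma ex_class_ext (C : category) (R S : pseudo_eqrel C) (f g : ex_premor R S) :
  proj1_sig f = proj1_sig g -> class (@ex_eqv C R S) f = class (@ex_eqv C R S) g.
Proof.
move=> e; congr (class _ _).
by apply: eq_sig_hprop => [h p q|]; [exact: proof_irrelevance | exact: e].
Qed.

Definition exact_completion (C : category) : category.
Proof.
refine (@Category (pseudo_eqrel C) (@ex_hom C) (@ex_id C) (@ex_comp C) _ _ _).
- move=> R S F; rewrite -(reprK F) ex_comp_class.
  by apply: ex_class_ext; exact: comp_idl.
- move=> R S F; rewrite -(reprK F) ex_comp_class.
  by apply: ex_class_ext; exact: comp_idr.
- move=> R S T W F G H; rewrite -(reprK F) -(reprK G) -(reprK H) !ex_comp_class.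
  by apply: ex_class_ext; exact: comp_assoc.
Defined.

Definition is_terminal (C : category) (T : C) : Prop :=
  forall A : C, exists! m : hom A T, True.

Definition is_product (C : category) (A B P : C)
    (p1 : hom P A) (p2 : hom P B) : Prop :=
  forall (T : C) (t1 : hom T A) (t2 : hom T B),
    exists! m : hom T P, p1 ∘ m = t1 /\ p2 ∘ m = t2.

(* [m] below is the arrow [h × id_A] between the products [Q] and [P]. *)
Definition is_exponential (C : category) (A B E P : C)
    (p1 : hom P E) (p2 : hom P A) (ev : hom P B) : Prop :=
  is_product p1 p2 /\
  forall (Z Q : C) (q1 : hom Q Z) (q2 : hom Q A) (g : hom Q B),
    is_product q1 q2 ->
    exists! h : hom Z E,
      exists m : hom Q P, p1 ∘ m = h ∘ q1 /\ p2 ∘ m = q2 /\ ev ∘ m = g.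

Definition cartesian_closed (C : category) : Prop :=
  (exists T : C, is_terminal T) /\
  (forall A B : C, exists (P : C) (p1 : hom P A) (p2 : hom P B), is_product p1 p2) /\
  (forall A B : C, exists (E P : C) (p1 : hom P E) (p2 : hom P A) (ev : hom P B),
     is_exponential p1 p2 ev).

(* Main.v *)
From Stdlib Require Import List Relations Classical ProofIrrelevance ssreflect.
Require Import Defs.

(** The exact completion is best understood through generalized elements: an
    arrow [T -> carrier A] is an element of [A] at stage [T], two elements are
    identified when they are [related], and an arrow of the completion is an
    operation on elements that respects [related], up to pointwise relatedness.

    Since universal arrows are only weak, a subobject of [X] in the completion
    is replaced by a predicate on generalized elements of [X], which
    is [representable] when it means factoring through some fixed arrow into
    [X]. Weak limits make equations representable and give closure under
    conjunction and substitution, existential quantification is composition, and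
    universal quantification ([representable_all]) comes from the right adjoints
    to weak pullback maps. Any representable predicate on pairs that
    is an equivalence relation at every stage gives an object of the completion
    ([pseudo_eqrel_of_equivalence]); terminal object, products and exponentials
    are all obtained in this way.

    For the exponential of [B] by [A], take a full diagram
    [U <- V -> carrier A], [f : V -> carrier B]. A point [u] of [U] codes a
    total multivalued function: its value at [a] is any [f v] with [v] above
    [(u, a)]. Say that [u] and [u'] [agree] when their values at related
    arguments are related. The relation [agree] is symmetric and transitive, and
    [agree u u] says that [u] codes a function from [A] to [B]. The exponential
    is the set of such [u] modulo [agree], a representable predicate by the
    closure properties above ([function_object_exists]).

    Fullness says that every multivalued function [V' -> carrier B] depending on
    a parameter in [U'] is refined by one coded in [U]: some of its values, at
    each argument, are those of the code. If the multivalued function represents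
    an arrow of the completion then all its values at an argument are related, so
    that the refinement defines the same arrow. This is currying. Uniqueness
    holds because [agree] is precisely pointwise equality. *)

Set Implicit Arguments.
Unset Strict Implicit.
Unset Printing Implicit Defensive.

Local Open Scope cat_scope.

(** * Weak limits of small shapes *)

(** Discrete diagrams give weak products of finite families, hence both the
    weak terminal object and binary weak products. *)
Definition discrete (I : Type) : category :=
  @Category I (fun i j => i = j) (@eq_refl I)
    (fun i j k g f => eq_trans f g)
    (fun i j _ => proof_irrelevance (i = j) _ _)
    (fun i j _ => proof_irrelevance (i = j) _ _)
    (fun i _ _ j _ _ _ => proof_irrelevance (i = j) _ _).

Lemma discrete_finite (I : Type) : finite_type I -> finite_category (discrete I).
Proof.
move=> fI; split=> // i j; case: (classic (i = j)) => [e|n].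
  by exists (e :: nil) => e'; left; exact: (proof_irrelevance (i = j)).
by exists nil => e; case: n.
Qed.

Definition discrete_diagram (I : Type) (C : category) (A : I -> C) :
  functor (discrete I) C.
Proof.
refine (@Functor (discrete I) C A
  (fun i j (u : i = j) => match u in _ = j return hom (A i) (A j) with
                          | eq_refl => idm (A i) end) _ _) => // i j k u v.
by case: _ / v; case: _ / u; rewrite comp_idl.
Defined.

Lemma weak_family_product (C : category) (HC : has_weak_finite_limits C)
    (I : Type) (fI : finite_type I) (A : I -> C) :
  exists (L : C) (p : forall i, hom L (A i)),
    forall (T : C) (t : forall i, hom T (A i)),
      exists m : hom T L, forall i, p i ∘ m = t i.
Proof.
have [L [p [_ w]]] := HC _ (discrete_diagram A) (discrete_finite fI).
exists L, p => T t; apply: (w T t) => i j u.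
by case: _ / u; rewrite /= comp_idl.
Qed.

Lemma weak_terminal_exists (C : category) (HC : has_weak_finite_limits C) :
  exists L : C, forall T : C, inhabited (hom T L).
Proof.
have fI : finite_type Empty_set by exists nil; case.
pose A (i : Empty_set) : C := match i with end.
have [L [p w]] := weak_family_product HC fI A.
by exists L => T; have [m _] := w T (fun i => match i with end).
Qed.

Lemma weak_product_exists (C : category) (HC : has_weak_finite_limits C) (A B : C) :
  exists (P : C) (p1 : hom P A) (p2 : hom P B), is_weak_product p1 p2.
Proof.
have fI : finite_type bool by exists (true :: false :: nil); case=> /=; tauto.
have [P [p w]] := weak_family_product HC fI (fun b : bool => if b then A else B).
exists P, (p true), (p false) => T t1 t2.
pose t b : hom T (if b then A else B) :=
  if b return hom T (if b then A else B) then t1 else t2.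
by have [m e] := w T t; exists m; split; [exact: (e true) | exact: (e false)].
Qed.

(** The vertex [true] carries the common domain, [false] the common codomain. *)
Definition pair_hom (i j : bool) : Set :=
  match i, j with
  | true, true | false, false => unit
  | true, false => bool
  | false, true => Empty_set
  end.

Definition pair_id (i : bool) : pair_hom i i :=
  match i with true | false => tt end.

Definition pair_comp (i j k : bool) : pair_hom j k -> pair_hom i j -> pair_hom i k :=
  match i, j, k return pair_hom j k -> pair_hom i j -> pair_hom i k with
  | true, true, true | false, false, false => fun _ _ => tt
  | true, true, false => fun g _ => g
  | true, false, false => fun _ f => f
  | true, false, true | false, false, true => fun g _ => match g with end
  | false, true, _ => fun _ f => match f with end
  end.

Definition parallel_pair : category.
Proof.
refine (@Category bool pair_hom pair_id pair_comp _ _ _).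
- by case; case=> //= [] [].
- by case; case=> //= [] [].
- by case; case; case; case => //= [] [] [].
Defined.

Lemma parallel_pair_finite : finite_category parallel_pair.
Proof.
split; first by exists (true :: false :: nil); case=> /=; tauto.
case; case=> /=.
- by exists (tt :: nil); case; left.
- by exists (true :: false :: nil); case=> /=; tauto.
- by exists nil; case.
- by exists (tt :: nil); case; left.
Qed.

Definition parallel_diagram (C : category) (A B : C) (a b : hom A B) :
  functor parallel_pair C.
Proof.
pose o (i : parallel_pair) : C := if i then A else B.
pose m (i j : parallel_pair) : hom i j -> hom (o i) (o j) :=
  match i, j return pair_hom i j -> hom (o i) (o j) with
  | true, true => fun _ => idm A
  | false, false => fun _ => idm B
  | true, false => fun u => if u then a else b
  | false, true => fun u => match u with end
  end.
apply: (@Functor parallel_pair C o m) => [[]//|].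
by case; case; case=> //= u v; rewrite ?comp_idl ?comp_idr; case: u v.
Defined.

(** Weak equalizers do not reduce to weak products and weak pullbacks in the
    usual way: pairings into a weak product are not unique, so an arrow that
    equalizes [a] and [b] need not factor through a weak pullback of a pairing
    of [a] and [b] along a diagonal. This is why parallel pairs are treated as
    a shape of their own. *)
Lemma weak_equalizer_exists (C : category) (HC : has_weak_finite_limits C)
    (A B : C) (a b : hom A B) :
  exists (L : C) (p : hom L A), a ∘ p = b ∘ p /\
    forall (T : C) (t : hom T A), a ∘ t = b ∘ t -> exists m : hom T L, p ∘ m = t.
Proof.
have [L [p [pc pw]]] := HC _ (parallel_diagram a b) parallel_pair_finite.
exists L, (p true); split.
  have e1 := pc true false true; have e2 := pc true false false.
  by rewrite /= in e1 e2; rewrite e1 e2.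
move=> T t e.
pose c (i : parallel_pair) : hom T (parallel_diagram a b i) :=
  match i with true => t | false => a ∘ t end.
have [|m Hm] := pw T c; last by exists m; exact: (Hm true).
by case; case=> //=; [move=> _; exact: comp_idl | case | move=> _; exact: comp_idl].
Qed.

(** * Predicates on generalized elements *)

(** The counterpart of a subobject: only the existence of a factorization is
    recorded, so [e] matters up to mutual factorization, that is, as an element
    of the poset reflection of the slice over [X]. *)
Definition representable (C : category) (X : C)
    (Phi : forall T : C, hom T X -> Prop) : Prop :=
  exists (E : C) (e : hom E X), forall (T : C) (x : hom T X),
    Phi T x <-> exists m : hom T E, e ∘ m = x.

Lemma representable_ext (C : category) (X : C)
    (Phi Psi : forall T : C, hom T X -> Prop) :
  (forall (T : C) (x : hom T X), Phi T x <-> Psi T x) ->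
  representable Phi -> representable Psi.
Proof. by move=> H [E [e He]]; exists E, e => T x; rewrite -H He. Qed.

Lemma representable_stable (C : category) (X : C)
    (Phi : forall T : C, hom T X -> Prop) (T Z : C) (x : hom T X) (t : hom Z T) :
  representable Phi -> Phi T x -> Phi Z (x ∘ t).
Proof.
move=> [E [e He]] /He [m em]; apply/He; exists (m ∘ t).
by rewrite comp_assoc em.
Qed.

Lemma representable_eq (C : category) (HC : has_weak_finite_limits C)
    (X Y : C) (a b : hom X Y) :
  representable (fun T (x : hom T X) => a ∘ x = b ∘ x).
Proof.
have [L [p [e w]]] := weak_equalizer_exists HC a b.
exists L, p => T x; split=> [|[m <-]]; first exact: w.
by rewrite !comp_assoc e.
Qed.

Lemma representable_pull (C : category) (HC : has_weak_finite_limits C)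
    (X Y : C) (f : hom Y X) (Phi : forall T : C, hom T X -> Prop) :
  representable Phi -> representable (fun T (y : hom T Y) => Phi T (f ∘ y)).
Proof.
move=> [E [e He]]; have [P [p [q [epq w]]]] := weak_pullback_exists HC f e.
exists P, p => T y; rewrite He; split=> [[m em]|[m <-]].
  by have [|n [n1 _]] := w T y m; [rewrite em | exists n].
by exists (q ∘ m); rewrite !comp_assoc epq.
Qed.

Lemma representable_and (C : category) (HC : has_weak_finite_limits C) (X : C)
    (Phi Psi : forall T : C, hom T X -> Prop) :
  representable Phi -> representable Psi ->
  representable (fun T x => Phi T x /\ Psi T x).
Proof.
move=> [E [e He]] /(representable_pull HC e) [D [d Hd]].
exists D, (e ∘ d) => T x; split=> [[/He [m em] Hx]|[m <-]].
  rewrite -em in Hx *; have [n <-] := proj1 (Hd T m) Hx.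
  by exists n; rewrite comp_assoc.
rewrite -comp_assoc; split; first by apply/He; exists (d ∘ m).
by apply/Hd; exists m.
Qed.

Lemma representable_ex (C : category) (X Y : C) (f : hom Y X)
    (Phi : forall T : C, hom T Y -> Prop) :
  representable Phi ->
  representable (fun T (x : hom T X) => exists y : hom T Y, f ∘ y = x /\ Phi T y).
Proof.
move=> [E [e He]]; exists E, (f ∘ e) => T x; split.
  by move=> [y [<- /He [m <-]]]; exists m; rewrite comp_assoc.
move=> [m <-]; exists (e ∘ m); rewrite comp_assoc; split=> //.
by apply/He; exists m.
Qed.

(** The Kripke-Joyal form of the universal quantifier along [f]. If [b]
    represents [Phi], the right adjoint sends the class of [b] to that of some
    [e], and the adjunction says that [x] factors through [e] if and only if the
    weak pullback of [x] along [f] factors through [b]. As every pair [(t, y)]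
    with [f ∘ y = x ∘ t] factors through this weak pullback, the latter
    condition means that [Phi] holds at all such [y]. *)
Lemma representable_all (C : category) (HC : has_weak_finite_limits C)
    (HA : has_right_adjoints_to_weak_pullback C)
    (X Y : C) (f : hom Y X) (Phi : forall T : C, hom T Y -> Prop) :
  representable Phi ->
  representable (fun T (x : hom T X) =>
    forall (Z : C) (t : hom Z T) (y : hom Z Y), f ∘ y = x ∘ t -> Phi Z y).
Proof.
move=> HPhi; have [B [b Hb]] := HPhi.
have [L [HL [R adj]]] := HA X Y f.
have [[E e] He] := class_surj (R (po_class (SliceOb b : slice Y))).
exists E, e => T x; have [P [p [q H]]] := weak_pullback_exists HC f x.
have LT := HL (SliceOb x : slice X) (SliceOb p : slice Y) q H.
have := adj (po_class (SliceOb x : slice X)) (po_class (SliceOb b : slice Y)).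
rewrite LT -He -/(@po_class (slice X) (SliceOb e)) !po_leE => adjTE.
case: H => epq w; split=> [Hx|[m em]].
  have /Hb [m em] := Hx _ _ _ epq.
  have [|[n en]] := proj1 adjTE; first by exists; exists m.
  by exists n.
have [|[n en]] := proj2 adjTE; first by exists; exists m.
move=> Z t y /w [k [<- _]]; apply: representable_stable => //.
by apply/Hb; exists n.
Qed.

(** Quantifying over the [y] that satisfy [Phi] is quantifying along the
    composite of [f] with an arrow representing [Phi], which spares a separate
    closure under implication. *)
Lemma representable_all_imp (C : category) (HC : has_weak_finite_limits C)
    (HA : has_right_adjoints_to_weak_pullback C)
    (X Y : C) (f : hom Y X) (Phi Psi : forall T : C, hom T Y -> Prop) :
  representable Phi -> representable Psi ->
  representable (fun T (x : hom T X) =>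
    forall (Z : C) (t : hom Z T) (y : hom Z Y), f ∘ y = x ∘ t -> Phi Z y -> Psi Z y).
Proof.
move=> [D [d Hd]] /(representable_pull HC d) /(representable_all HC HA (f ∘ d)).
apply: representable_ext => T x; split=> [H Z t y e /Hd [m em]|H Z t y e].
  by rewrite -em; apply: (H _ t); rewrite -comp_assoc em.
by apply: (H _ t); [rewrite comp_assoc | apply/Hd; exists y].
Qed.

(** * Pseudo equivalence relations through generalized elements *)

(** Equality of generalized elements in the quotient presented by [A]. *)
Definition related (C : category) (A : pseudo_eqrel C) (T : C)
    (a a' : hom T (carrier A)) : Prop :=
  exists r : hom T (rel A), src A ∘ r = a /\ tgt A ∘ r = a'.

Lemma related_refl (C : category) (A : pseudo_eqrel C) (T : C)
    (a : hom T (carrier A)) : related a a.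
Proof.
have [rho [e1 e2]] := per_refl A.
by exists (rho ∘ a); rewrite !comp_assoc e1 e2 comp_idl.
Qed.

Lemma related_sym (C : category) (A : pseudo_eqrel C) (T : C)
    (a a' : hom T (carrier A)) : related a a' -> related a' a.
Proof.
move=> [r [<- <-]]; have [sigma [e1 e2]] := per_sym A.
by exists (sigma ∘ r); rewrite !comp_assoc e1 e2.
Qed.

Lemma related_trans (C : category) (A : pseudo_eqrel C) (T : C)
    (a b c : hom T (carrier A)) : related a b -> related b c -> related a c.
Proof.
move=> [r [<- r2]] [s [s1 <-]].
have [P [p [q [[_ w] [tau [e1 e2]]]]]] := per_trans A.
have [|m [<- <-]] := w T r s; first by rewrite r2 s1.
by exists (tau ∘ m); rewrite !comp_assoc e1 e2.
Qed.

Lemma related_comp (C : category) (A : pseudo_eqrel C) (T Z : C)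
    (a a' : hom T (carrier A)) (t : hom Z T) :
  related a a' -> related (a ∘ t) (a' ∘ t).
Proof. by move=> [r [<- <-]]; exists (r ∘ t); rewrite !comp_assoc. Qed.

Lemma representable_related (C : category) (HC : has_weak_finite_limits C)
    (A : pseudo_eqrel C) (X : C) (a b : hom X (carrier A)) :
  representable (fun T (x : hom T X) => related (a ∘ x) (b ∘ x)).
Proof.
have [P [p [q w]]] := weak_product_exists HC X (rel A).
have Hsrc := representable_eq HC (src A ∘ q) (a ∘ p).
have Htgt := representable_eq HC (tgt A ∘ q) (b ∘ p).
apply: representable_ext (representable_ex p (representable_and HC Hsrc Htgt)).
move=> T x; split=> [[y [<- []]]|[r [e1 e2]]].
  by rewrite -!comp_assoc => e1 e2; exists (q ∘ y).
have [m [m1 m2]] := w T x r; exists m.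
by rewrite -!comp_assoc m1 m2.
Qed.

(** The main source of objects of the completion. [Theta] is represented on a
    weak product of [X] with itself; as every pair of elements lifts to it,
    [Theta] is the relation of the resulting span, and the structure of a
    pseudo equivalence relation is read off at the stages [X], [R] and a weak
    pullback of [R] with itself. The fields are quantified one by one so
    that the carrier is [X] by computation. *)
Lemma pseudo_eqrel_of_equivalence (C : category) (HC : has_weak_finite_limits C)
    (X : C) (Theta : forall T : C, hom T X -> hom T X -> Prop) :
  (forall (D : C) (a b : hom D X),
     representable (fun T (d : hom T D) => Theta T (a ∘ d) (b ∘ d))) ->
  (forall T : C, equivalence (hom T X) (Theta T)) ->
  exists (R : C) (r1 r2 : hom R X) (Hr : pseudo_reflexive r1 r2)
    (Hs : pseudo_symmetric r1 r2) (Ht : pseudo_transitive r1 r2),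
    forall (T : C) (x y : hom T X),
      @related C (PseudoEqrel Hr Hs Ht) T x y <-> Theta T x y.
Proof.
move=> Hrep Heq; have [W [w1 [w2 w]]] := weak_product_exists HC X X.
have [R [r Hr]] := Hrep W w1 w2.
have HR T (x y : hom T X) : Theta T x y <->
    exists m : hom T R, w1 ∘ r ∘ m = x /\ w2 ∘ r ∘ m = y.
  have [p [<- <-]] := w T x y; split=> [/Hr [m <-]|[m [<- <-]]].
    by exists m; rewrite !comp_assoc.
  by rewrite -!(comp_assoc m r); apply/Hr; exists m.
have Hself : Theta R (w1 ∘ r) (w2 ∘ r).
  by apply/HR; exists (idm R); rewrite !comp_idr.
have Hrefl : pseudo_reflexive (w1 ∘ r) (w2 ∘ r).
  by apply/HR; have [refl _ _] := Heq X; exact: refl.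
have Hsym : pseudo_symmetric (w1 ∘ r) (w2 ∘ r).
  by apply/HR; have [_ _ sym] := Heq R; exact: sym.
have Htrans : pseudo_transitive (w1 ∘ r) (w2 ∘ r).
  have [P [p [q H]]] := weak_pullback_exists HC (w2 ∘ r) (w1 ∘ r).
  exists P, p, q; split=> //; apply/HR.
  have [_ trans _] := Heq P; apply: (trans _ (w2 ∘ r ∘ p)).
    by apply/HR; exists p.
  by rewrite (proj1 H); apply/HR; exists q.
by exists R, (w1 ∘ r), (w2 ∘ r), Hrefl, Hsym, Htrans => T x y; rewrite HR.
Qed.

(** * Arrows of the exact completion through representatives *)

Definition respects (C : category) (A B : pseudo_eqrel C)
    (f : hom (carrier A) (carrier B)) : Prop :=
  forall (T : C) (a a' : hom T (carrier A)),
    related a a' -> related (f ∘ a) (f ∘ a').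

Lemma respects_premor (C : category) (A B : pseudo_eqrel C)
    (f : hom (carrier A) (carrier B)) :
  respects f <-> exists fh : hom (rel A) (rel B),
    src B ∘ fh = f ∘ src A /\ tgt B ∘ fh = f ∘ tgt A.
Proof.
split=> [H|[fh [e1 e2]] T a a' [r [<- <-]]].
  by apply: H; exists (idm (rel A)); rewrite !comp_idr.
by exists (fh ∘ r); rewrite !comp_assoc e1 e2.
Qed.

Lemma respects_comp (C : category) (A B D : pseudo_eqrel C)
    (f : hom (carrier A) (carrier B)) (g : hom (carrier B) (carrier D)) :
  respects f -> respects g -> respects (g ∘ f).
Proof. by move=> Hf Hg T a a' /Hf /Hg; rewrite !comp_assoc. Qed.

(** Every arrow of the completion has this form ([ex_map_surj]), and its
    identity depends only on [f] up to [related] ([ex_map_eq]): together with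
    [ex_map_comp] this avoids any further use of quotients. *)
Definition ex_map (C : category) (A B : pseudo_eqrel C)
    (f : hom (carrier A) (carrier B)) (Hf : respects f) :
  @hom (exact_completion C) A B :=
  class (@ex_eqv C A B) (exist _ f (proj1 (respects_premor f) Hf)).

Lemma ex_map_surj (C : category) (A B : pseudo_eqrel C)
    (F : @hom (exact_completion C) A B) :
  exists (f : hom (carrier A) (carrier B)) (Hf : respects f), F = ex_map Hf.
Proof.
have [[f Hf] <-] := class_surj F.
by exists f, (proj2 (respects_premor f) Hf); apply: ex_class_ext.
Qed.

Lemma ex_map_eq (C : category) (A B : pseudo_eqrel C)
    (f g : hom (carrier A) (carrier B)) (Hf : respects f) (Hg : respects g) :
  ex_map Hf = ex_map Hg <-> related f g.
Proof. exact: class_eq (@ex_eqv_equivalence C A B) _ _. Qed.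

Lemma ex_map_comp (C : category) (A B D : pseudo_eqrel C)
    (f : hom (carrier A) (carrier B)) (g : hom (carrier B) (carrier D))
    (Hf : respects f) (Hg : respects g) :
  ex_map Hg ∘ ex_map Hf = ex_map (respects_comp Hf Hg).
Proof.
rewrite /ex_map; etransitivity; first exact: ex_comp_class.
exact: ex_class_ext.
Qed.

(** * Finite products of the exact completion *)

Lemma ex_terminal_exists (C : category) (HC : has_weak_finite_limits C) :
  exists T : exact_completion C, is_terminal T.
Proof.
have [L w] := weak_terminal_exists HC.
have [|T|R [r1 [r2 [Hr [Hs [Ht HR]]]]]] :=
    @pseudo_eqrel_of_equivalence C HC L (fun _ _ _ => True).
- move=> D _ _; exists D, (idm D) => T x; split=> // _.
  by exists x; rewrite comp_idl.
- by split.
- exists (PseudoEqrel Hr Hs Ht) => A; have [m] := w (carrier A).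
have Hm : @respects C A (PseudoEqrel Hr Hs Ht) m by move=> T a a' _; apply/HR.
exists (ex_map Hm); split=> // F _; have [f [Hf ->]] := ex_map_surj F.
by apply/ex_map_eq; apply/HR.
Qed.

(** A product of the completion in which pairs of elements of [A] and [B] can be
    lifted on the nose, not merely up to [related]. The construction of
    exponentials needs such liftings, while [is_product] only determines an
    object up to isomorphism of the completion. *)
Definition presents_product (C : category) (A B P : pseudo_eqrel C)
    (p1 : hom (carrier P) (carrier A)) (p2 : hom (carrier P) (carrier B)) : Prop :=
  is_weak_product p1 p2 /\
  forall (T : C) (x y : hom T (carrier P)),
    related x y <-> related (p1 ∘ x) (p1 ∘ y) /\ related (p2 ∘ x) (p2 ∘ y).

Lemma presented_product_exists (C : category) (HC : has_weak_finite_limits C)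
    (A B : pseudo_eqrel C) :
  exists (P : pseudo_eqrel C) (p1 : hom (carrier P) (carrier A))
    (p2 : hom (carrier P) (carrier B)), presents_product p1 p2.
Proof.
have [P [p1 [p2 w]]] := weak_product_exists HC (carrier A) (carrier B).
have [||R [r1 [r2 [Hr [Hs [Ht HR]]]]]] :=
    @pseudo_eqrel_of_equivalence C HC P (fun T x y =>
      related (p1 ∘ x) (p1 ∘ y) /\ related (p2 ∘ x) (p2 ∘ y)).
- move=> D a b.
  have H1 := representable_related HC (p1 ∘ a) (p1 ∘ b).
  have H2 := representable_related HC (p2 ∘ a) (p2 ∘ b).
  apply: representable_ext (representable_and HC H1 H2) => T x.
  by rewrite -!comp_assoc.
- move=> T; split=> [x|x y z [H1 H2] [H3 H4]|x y [H1 H2]].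
  + by split; exact: related_refl.
  + by split; [exact: related_trans H1 H3 | exact: related_trans H2 H4].
  + by split; exact: related_sym.
- by exists (PseudoEqrel Hr Hs Ht), p1, p2.
Qed.

Lemma presents_product_respects (C : category) (A B P : pseudo_eqrel C)
    (p1 : hom (carrier P) (carrier A)) (p2 : hom (carrier P) (carrier B)) :
  presents_product p1 p2 -> respects p1 /\ respects p2.
Proof. by move=> [_ H]; split=> T x y /H []. Qed.

Lemma presents_product_is_product (C : category) (A B P : pseudo_eqrel C)
    (p1 : hom (carrier P) (carrier A)) (p2 : hom (carrier P) (carrier B))
    (H1 : respects p1) (H2 : respects p2) :
  presents_product p1 p2 -> is_product (ex_map H1) (ex_map H2).
Proof.
move=> [w H] T T1 T2.
have [t1 [Ht1 ->]] := ex_map_surj T1; have [t2 [Ht2 ->]] := ex_map_surj T2.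
have [m [m1 m2]] := w _ t1 t2.
have Hm : @respects C T P m.
  by move=> Z a a' r; apply/H; rewrite !comp_assoc m1 m2; split; [apply: Ht1 | apply: Ht2].
exists (ex_map Hm); split.
  by rewrite !ex_map_comp !ex_map_eq m1 m2; split; exact: related_refl.
move=> N; have [n [Hn ->]] := ex_map_surj N; rewrite !ex_map_comp !ex_map_eq.
by move=> [e1 e2]; apply/H; rewrite m1 m2; split; exact: related_sym.
Qed.

(** * Exponentials of the exact completion *)

(** The universal property of an exponential tests all products of [Z] and [A];
    one of them suffices since they are isomorphic. This lets currying be carried
    out on a presented product only. *)
Lemma is_exponential_from_some_product (C : category) (A B E P : C)
    (p1 : hom P E) (p2 : hom P A) (ev : hom P B) :
  is_product p1 p2 ->
  (forall Z : C, exists (G : C) (g1 : hom G Z) (g2 : hom G A),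
     is_product g1 g2 /\
     forall g : hom G B, exists! h : hom Z E,
       exists m : hom G P, p1 ∘ m = h ∘ g1 /\ p2 ∘ m = g2 /\ ev ∘ m = g) ->
  is_exponential p1 p2 ev.
Proof.
move=> HP Hsome; split=> // Z Q q1 q2 g HQ.
have [G [g1 [g2 [HG H]]]] := Hsome Z.
have [i [[i1 i2] _]] := HQ G g1 g2; have [j [[j1 j2] _]] := HG Q q1 q2.
have ij : i ∘ j = idm Q.
  have [u [_ uniq]] := HQ Q q1 q2.
  have <- : u = i ∘ j by apply: uniq; rewrite !comp_assoc i1 i2.
  by apply: uniq; rewrite !comp_idr.
have [h [[m [m1 [m2 m3]]] uniq]] := H (g ∘ i).
exists h; split.
  by exists (m ∘ j); rewrite !comp_assoc m1 m2 m3 -!comp_assoc j1 ij comp_idr.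
move=> h' [m' [n1 [n2 n3]]]; apply: uniq; exists (m' ∘ i).
by rewrite !comp_assoc n1 n2 n3 -!comp_assoc i1.
Qed.

(** The codes [u] and [u'] have related values at related arguments, tested at
    all later stages [Z] since a value of a code exists only after lifting. In
    particular [agree u u] means that the multivalued function coded by [u] is
    single-valued and extensional. *)
Definition agree (C : category) (A B : pseudo_eqrel C) (U V : C)
    (p1 : hom V U) (p2 : hom V (carrier A)) (f : hom V (carrier B))
    (T : C) (u u' : hom T U) : Prop :=
  forall (Z : C) (t : hom Z T) (v v' : hom Z V),
    p1 ∘ v = u ∘ t -> p1 ∘ v' = u' ∘ t ->
    related (p2 ∘ v) (p2 ∘ v') -> related (f ∘ v) (f ∘ v').

(** [agree] is a universal quantification over the pairs [(v, v')] of elements of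
    [V], with both the hypotheses and the conclusion representable. *)
Lemma representable_agree (C : category) (HC : has_weak_finite_limits C)
    (HA : has_right_adjoints_to_weak_pullback C)
    (A B : pseudo_eqrel C) (U V : C)
    (p1 : hom V U) (p2 : hom V (carrier A)) (f : hom V (carrier B))
    (D : C) (a b : hom D U) :
  representable (fun T (d : hom T D) => agree p1 p2 f (a ∘ d) (b ∘ d)).
Proof.
have [M [m1 [m2 wM]]] := weak_product_exists HC V V.
have [N [n1 [n2 wN]]] := weak_product_exists HC D M.
have Hl := representable_eq HC (p1 ∘ (m1 ∘ n2)) (a ∘ n1).
have Hr := representable_eq HC (p1 ∘ (m2 ∘ n2)) (b ∘ n1).
have Hp := representable_related HC (p2 ∘ (m1 ∘ n2)) (p2 ∘ (m2 ∘ n2)).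
have Hf := representable_related HC (f ∘ (m1 ∘ n2)) (f ∘ (m2 ∘ n2)).
apply: representable_ext (representable_all_imp HC HA n1
  (representable_and HC Hl (representable_and HC Hr Hp)) Hf) => T d.
split=> [H Z t v v' ev ev' Hv|H Z t y e [ev [ev' Hv]]].
  have [m [em em']] := wM Z v v'; have [n [en en']] := wN Z (d ∘ t) m.
  have := H Z t n en; rewrite -!comp_assoc en en' em em'.
  by apply; rewrite !comp_assoc -(comp_assoc t d a) -(comp_assoc t d b);
    rewrite ev ev' !comp_assoc.
move: ev ev' Hv; rewrite -!comp_assoc e => ev ev' Hv.
by apply: (H Z t) => //; rewrite -comp_assoc.
Qed.

Lemma agree_sym (C : category) (A B : pseudo_eqrel C) (U V : C)
    (p1 : hom V U) (p2 : hom V (carrier A)) (f : hom V (carrier B))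
    (T : C) (u u' : hom T U) : agree p1 p2 f u u' -> agree p1 p2 f u' u.
Proof.
by move=> H Z t v v' e e' r; apply/related_sym/(H Z t) => //; exact: related_sym.
Qed.

(** Totality of the multivalued functions is what makes this work: a value of
    [u'] at the argument of [v] exists, as [V] is a weak product, and
    interpolates between [f ∘ v] and [f ∘ v'']. *)
Lemma agree_trans (C : category) (A B : pseudo_eqrel C) (U V : C)
    (p1 : hom V U) (p2 : hom V (carrier A)) (f : hom V (carrier B))
    (w : is_weak_product p1 p2) (T : C) (u u' u'' : hom T U) :
  agree p1 p2 f u u' -> agree p1 p2 f u' u'' -> agree p1 p2 f u u''.
Proof.
move=> H H' Z t v v'' e e'' r; have [v' [e' ev']] := w Z (u' ∘ t) (p2 ∘ v).
apply: (@related_trans _ _ _ _ (f ∘ v')).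
  by apply: (H Z t) => //; rewrite ev'; exact: related_refl.
by apply: (H' Z t) => //; rewrite ev'.
Qed.

(** The object of codes of functions: the elements of [U] that agree with
    themselves, modulo [agree]. It uses only that the multivalued functions coded
    by [U] are total; fullness serves to show that there are enough of them. *)
Lemma function_object_exists (C : category) (HC : has_weak_finite_limits C)
    (HA : has_right_adjoints_to_weak_pullback C)
    (A B : pseudo_eqrel C) (U V : C)
    (p1 : hom V U) (p2 : hom V (carrier A)) (f : hom V (carrier B)) :
  is_weak_product p1 p2 ->
  exists (E : pseudo_eqrel C) (e : hom (carrier E) U),
    (forall (T : C) (u : hom T U),
       agree p1 p2 f u u -> exists x : hom T (carrier E), e ∘ x = u) /\
    forall (T : C) (x y : hom T (carrier E)),
      related x y <-> agree p1 p2 f (e ∘ x) (e ∘ y).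
Proof.
move=> w; have := representable_agree HC HA p1 p2 f (idm U) (idm U).
move=> [E [e He]].
have [||R [r1 [r2 [Hr [Hs [Ht HR]]]]]] :=
    @pseudo_eqrel_of_equivalence C HC E (fun T x y =>
      agree p1 p2 f (e ∘ x) (e ∘ y)).
- move=> D a b; have := representable_agree HC HA p1 p2 f (e ∘ a) (e ∘ b).
  by apply: representable_ext => T x; rewrite -!comp_assoc.
- move=> T; split=> [x|x y z|x y].
  + have := proj2 (He T (e ∘ x)) (ex_intro _ x eq_refl).
    by rewrite comp_idl.
  + exact: agree_trans.
  + exact: agree_sym.
- exists (PseudoEqrel Hr Hs Ht), e; split=> // T u Hu.
by apply/He; rewrite comp_idl.
Qed.

(** Evaluation picks the value [f ∘ v] for a lifting [v] of (code, argument) to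
    [V]. To curry a representative [g] on a presented product [G] of [Z] and [A],
    view [G] with [g] as a [Z]-indexed multivalued function and refine it by
    fullness through [h : carrier Z -> U]. *)
Lemma ex_exponential_exists (C : category) (HC : has_weak_finite_limits C)
    (HA : has_right_adjoints_to_weak_pullback C) (HF : has_full_diagrams C)
    (A B : exact_completion C) :
  exists (E P : exact_completion C) (p1 : hom P E) (p2 : hom P A) (ev : hom P B),
    is_exponential p1 p2 ev.
Proof.
have [U [V [p1 [p2 [f [w full]]]]]] := HF (carrier A) (carrier B).
have [E [e [He HE]]] := function_object_exists HC HA f w.
have [P [d1 [d2 HP]]] := presented_product_exists HC E A.
have [Hd1 Hd2] := presents_product_respects HP.
have [v [v1 v2]] := w _ (e ∘ d1) d2.
have Hev : @respects C P B (f ∘ v).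
  move=> T x y /(proj2 HP) [/HE H1 H2]; rewrite -!comp_assoc.
  by apply: (H1 T (idm T)); rewrite ?comp_idr !comp_assoc ?v1 ?v2.
exists E, P, (ex_map Hd1), (ex_map Hd2), (ex_map Hev).
apply: is_exponential_from_some_product; first exact: presents_product_is_product.
move=> Z; have [G [q1 [q2 HG]]] := presented_product_exists HC Z A.
have [Hq1 Hq2] := presents_product_respects HG.
exists G, (ex_map Hq1), (ex_map Hq2); split; first exact: presents_product_is_product.
move=> F; have [g [Hg ->]] := ex_map_surj F.
have [h [N [r [q [k [[_ wN] [k1 [k2 k3]]]]]]]] := full _ _ _ _ g (proj1 HG).
(* What fullness provides: any value of the code [h ∘ z] is also a value of
   [g] at [z] and the same argument. *)
have key T (z : hom T (carrier Z)) (y : hom T V) : p1 ∘ y = h ∘ z ->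
    exists x : hom T (carrier G), q1 ∘ x = z /\ q2 ∘ x = p2 ∘ y /\ g ∘ x = f ∘ y.
  move=> ey; have [|n [n1 n2]] := wN T z y; first by rewrite ey.
  by exists (k ∘ n); rewrite !comp_assoc k1 k2 k3 -!comp_assoc n1 n2.
(* Hence values of [h ∘ z] and [h ∘ z'] are values of [g], which respects the
   relation of [G]; so [h] lands in codes of functions and respects [Z]. *)
have agr T (z z' : hom T (carrier Z)) : related z z' ->
    agree p1 p2 f (h ∘ z) (h ∘ z').
  move=> rz X t y y'; rewrite -!comp_assoc.
  move=> /key [x [x1 [x2 <-]]] /key [x' [x1' [x2' <-]]] ry.
  apply: Hg; apply/(proj2 HG); rewrite x1 x1' x2 x2'; split=> //.
  exact: related_comp.
have [|h' eh] := He _ h.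
  by rewrite -(comp_idr h); apply: agr; exact: related_refl.
have Hh : @respects C Z E h'.
  by move=> T z z' rz; apply/HE; rewrite !comp_assoc eh; exact: agr.
have [m [m1 m2]] := proj1 HP _ (h' ∘ q1) q2.
have Hm : @respects C G P m.
  move=> T x y /(proj2 HG) [r1 r2]; apply/(proj2 HP).
  by rewrite !comp_assoc m1 m2 -!comp_assoc; split=> //; exact: Hh.
exists (ex_map Hh); split.
  exists (ex_map Hm); rewrite !ex_map_comp !ex_map_eq m1 m2.
  split; first exact: related_refl; split; first exact: related_refl.
  (* The evaluation of [m] is a value of [g] at an element [x] of [G] with the
     same projections as the generic element, hence related to it. *)
  have [|x [x1 [x2 x3]]] := key _ q1 (v ∘ m).
    by rewrite comp_assoc v1 -comp_assoc m1 comp_assoc eh.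
  rewrite -comp_assoc -x3 -{2}(comp_idr g).
  apply: Hg; apply/(proj2 HG); rewrite x1 x2 !comp_idr comp_assoc v2 m2.
  by split; exact: related_refl.
(* Uniqueness: a value of [h] at [z] is a value [g ∘ x], hence related to the
   evaluation of [h2] at [z] and the same argument, and [h2 ∘ z] agrees with
   itself. *)
move=> H' [M' []]; have [h2 [Hh2 ->]] := ex_map_surj H'.
have [m' [Hm' ->]] := ex_map_surj M'.
rewrite !ex_map_comp !ex_map_eq => n1 [n2 n3].
apply/HE; rewrite eh => T z y y' ey ey' ry.
have [x [x1 [x2 <-]]] := key _ _ _ ey.
have := related_comp x n1; have := related_comp x n2; have := related_comp x n3.
rewrite -!comp_assoc x1 x2 => b3 b2 b1.
apply: related_trans (related_sym b3) _.
(* [v ∘ (m' ∘ x)] lies over [e ∘ (d1 ∘ (m' ∘ x))], a code that equals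
   [e ∘ (h2 ∘ z)] only up to [agree]. *)
move/HE: b1 => b1; apply: (b1 _ (idm T)).
- by rewrite comp_idr !comp_assoc v1.
- by rewrite comp_idr ey' comp_assoc.
- by rewrite comp_assoc v2; exact: related_trans b2 ry.
Qed.

Theorem theorem2p7 (C : category)
  (HwL : has_weak_finite_limits C)
  (Hadj : has_right_adjoints_to_weak_pullback C)
  (Hfull : has_full_diagrams C) :
  cartesian_closed (exact_completion C).
Proof.
split; first exact: ex_terminal_exists.
split=> A B; last exact: ex_exponential_exists.
have [P [p1 [p2 HP]]] := presented_product_exists HwL A B.
have [H1 H2] := presents_product_respects HP.
by exists P, (ex_map H1), (ex_map H2); exact: presents_product_is_product.
Qed.
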